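(* Let $t\ge 1$ be an integer and let $H$ be a graph with vertex set $\{v_1,v_2,\dots,v_n\}$. Let $G$ be the graph obtained from $n+1$ pairwise disjoint graphs $H,H_1,H_2,\dots,H_n$ by adding a new vertex $x$, joining all vertices of $H_1,H_2,\dots,H_n$ to $x$, and joining all vertices of $H_i$ to $v_i$, for $i=1,2,\dots,n$. If $H_1,H_2,\dots,H_n$ are $t$-chromatic graphs and $\chi(H)\ge 3$, then $\chi_c(G)\ge t+2$.
   Context: Graphs are finite, simple and undirected. For positive integers $k\ge 2d$, a $(k,d)$-coloring of $G$ is a map $f:V(G)\to\{0,1,\dots,k-1\}$ such that $d\le |f(x)-f(y)|\le k-d$ for every edge $xy$; $G$ is $(k,d)$-colorable if it has one. The circular chromatic number is $\chi_c(G)=\inf\{k/d: G\text{ is }(k,d)\text{-colorable}\}$. $\chi$ denotes the (ordinary) chromatic number, and a graph is $t$-chromatic if its chromatic number equals $t$. The only edges of $G$ are those of $H,H_1,\dots,H_n$ and those added by the described joining operations. *)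

(* Defs.v *)
From HB Require Import structures.
From mathcomp Require Import all_boot all_order all_algebra.
From mathcomp Require Import classical_sets reals.

Set Implicit Arguments.
Unset Strict Implicit.
Unset Printing Implicit Defensive.

Import Order.TTheory GRing.Theory Num.Theory.

Record sgraph := SGraph {
  vertex :> finType;
  adj : rel vertex;
  adj_sym : symmetric adj;
  adj_irrefl : irreflexive adj }.

Definition proper_coloring (G : sgraph) (k : nat) (f : G -> 'I_k) : bool :=
  [forall x, forall y, adj x y ==> (f x != f y)].

Definition colorable (G : sgraph) (k : nat) : bool :=
  [exists f : {ffun G -> 'I_k}, proper_coloring f].

Lemma colorable_ex (G : sgraph) : exists k, colorable G k.
Proof.
exists #|G|; apply/existsP; exists [ffun x => enum_rank x].
apply/forallP => x; apply/forallP => y; apply/implyP => xy; rewrite !ffunE.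
by apply: contraTneq xy => /enum_rank_inj ->; rewrite adj_irrefl.
Qed.

Definition chromatic_number (G : sgraph) : nat := ex_minn (colorable_ex G).

(* The difference inside the absolute value is taken in int, not truncated. *)
Definition kd_coloring (G : sgraph) (k d : nat) (f : G -> 'I_k) : Prop :=
  forall x y : G, adj x y -> (d <= `|f x - f y| <= k - d)%N.

Definition kd_colorable (G : sgraph) (k d : nat) : Prop :=
  exists f : G -> 'I_k, kd_coloring d f.

Local Open Scope ring_scope.
Local Open Scope classical_set_scope.

Definition circular_chromatic_number (R : realType) (G : sgraph) : R :=
  inf [set r : R | exists k d : nat,
    [/\ (0 < d)%N, (2 * d <= k)%N, kd_colorable G k d & r = k%:R / d%:R]].

Local Close Scope classical_set_scope.
Local Close Scope ring_scope.

Section Join.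
Variables (H : sgraph) (n : nat) (v : 'I_n -> H) (Hs : 'I_n -> sgraph).

(* None is the new vertex x, Some (inl u) is the vertex u of H, and
   Some (inr (Tagged _ w)), with w : Hs i, is the vertex w of Hs i. *)
Definition join_vertex : finType := option (H + {i : 'I_n & Hs i}).

Definition join_adj : rel join_vertex := fun a b =>
  match a, b with
  | None, Some (inr _) | Some (inr _), None => true
  | Some (inl u), Some (inl u') => adj u u'
  | Some (inl u), Some (inr w) | Some (inr w), Some (inl u) => u == v (tag w)
  | Some (inr w), Some (inr w') =>
      (tag w == tag w') && adj (tagged w) (tagged_as w w')
  | _, _ => false
  end.

Lemma join_adj_sym : symmetric join_adj.
Proof.
move=> [[u|[i w]]|] [[u'|[j w']]|] //=; first exact: adj_sym.
have [ij|//] := eqVneq i j; by subst j; rewrite !tagged_asE adj_sym.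
Qed.

Lemma join_adj_irrefl : irreflexive join_adj.
Proof.
by move=> [[u|[i w]]|] //=; rewrite ?eqxx ?tagged_asE adj_irrefl.
Qed.

Definition join_graph : sgraph := SGraph join_adj_sym join_adj_irrefl.

End Join.

(* Main.v *)
Require Import Defs.
From mathcomp Require Import all_boot all_order all_algebra.
From mathcomp Require Import reals.
From mathcomp Require Import zify.

(** Suppose that the join has a (k,d)-coloring f with k < (t+2)d, and rotate it
    so that the apex x gets color 0.  Think of the colors as points of a circle
    of length k.  A color class in the ordinary sense arises from every arc of d
    consecutive colors, since adjacent vertices are at distance at least d.

    If some v_i has a color c at circular distance at least d from 0, then the
    colors of H_i, whose vertices see both x and v_i, lie in [d, c-d] and
    [c+d, k-d].  These two arcs are covered by floor(c/d) - 1 and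
    floor((k-c)/d) - 1 arcs of d colors, hence by at most
    floor(k/d) - 2 <= t - 1 of them in total, and H_i would be
    (t-1)-colorable ([chromatic_number_common_neighbors]).

    So all vertices of H have colors in [0, d) or in (k-d, k).  These two arcs
    are independent, so H would be 2-colorable.  Therefore k/d >= t+2 for every
    (k,d)-coloring, and the infimum inherits the bound because it is taken over
    a nonempty set. *)

Lemma chromatic_number_le {K : sgraph} {m : nat} (h : K -> nat) :
  (forall w, h w < m) -> (forall w w', adj w w' -> h w <> h w') ->
  chromatic_number K <= m.
Proof.
move=> hm hP; rewrite /chromatic_number; case: ex_minnP => p _; apply.
apply/existsP; exists [ffun w => Ordinal (hm w)].
apply/forallP => w; apply/forallP => w'; apply/implyP => /hP ww'.
by rewrite !ffunE; apply/eqP => -[].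
Qed.

Lemma eq_divn_dist {d a b : nat} :
  0 < d -> a %/ d = b %/ d -> `|(a : int) - b|%N < d.
Proof.
move=> d_gt0 ab; have := ltn_pmod a d_gt0; have := ltn_pmod b d_gt0.
by have := divn_eq a d; have := divn_eq b d; rewrite ab; lia.
Qed.

Lemma kd_coloring_rotate {G : sgraph} {k d : nat} (x : G) :
  kd_colorable G k d -> exists2 f : G -> 'I_k, kd_coloring d f & f x = 0 :> nat.
Proof.
move=> [f fP].
pose g y := if f x <= f y then f y - f x else f y + k - f x.
have g_lt y : g y < k.
  by rewrite /g; have := ltn_ord (f y); have := ltn_ord (f x); case: (leqP (f x)); lia.
exists (fun y => Ordinal (g_lt y)); last by rewrite /= /g leqnn subnn.
move=> y z /fP /=; rewrite /g.
have := ltn_ord (f x); have := ltn_ord (f y); have := ltn_ord (f z).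
by case: (leqP (f x) (f y)); case: (leqP (f x) (f z)); lia.
Qed.

(** The images of [e] avoid the open arcs of radius d around the colors 0 of [x]
    and [c] of [u], which do not contain each other's center; what remains are
    two arcs that together are covered by m arcs of d consecutive colors. *)
Lemma chromatic_number_common_neighbors {G K : sgraph} {k d m : nat}
    {f : G -> 'I_k} {x u : G} (e : K -> G) :
  0 < d -> k < (m + 3) * d -> kd_coloring d f ->
  f x = 0 :> nat -> d <= f u <= k - d ->
  {homo e : w w' / adj w w'} ->
  (forall w, adj x (e w)) -> (forall w, adj u (e w)) ->
  chromatic_number K <= m.
Proof.
move=> d_gt0 k_lt fP fx0 fu eP xe ue.
pose c : nat := f u; pose q := c %/ d; rewrite -/c in fu.
have q_gt0 : 0 < q by rewrite divn_gt0 //; lia.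
have q_le : q * d <= c by exact: leq_divM.
have q_gt : c < q.+1 * d by exact: ltn_ceil.
(* The arcs below c get the numbers 0, ..., q-2, those above c start at q-1. *)
pose h w := if f (e w) < c then f (e w) %/ d - 1
            else (f (e w) - c) %/ d + q - 2.
have low w : f (e w) < c -> 0 < f (e w) %/ d < q.
  move=> lt_c; have := fP _ _ (xe w); have := fP _ _ (ue w).
  by rewrite fx0 -/c divn_gt0 // ltn_divLR //; nia.
have high w : c <= f (e w) ->
    0 < (f (e w) - c) %/ d /\ (f (e w) - c) %/ d + q < m + 2.
  move=> le_c; have := fP _ _ (xe w); have := fP _ _ (ue w).
  have := leq_divM (f (e w) - c) d.
  by rewrite fx0 -/c divn_gt0 //; nia.
have q_lt : q < m + 2 by nia.
apply: (chromatic_number_le h) => [w | w w' ww'].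
  by rewrite /h; case: (ltnP (f (e w)) c) => [/low|/high]; lia.
have := fP _ _ (eP _ _ ww'); rewrite /h.
case: (ltnP (f (e w)) c) => [/[dup] wc /low|/[dup] wc /high] wq;
  case: (ltnP (f (e w')) c) => [/[dup] wc' /low|/[dup] wc' /high] wq' dist hh.
- have /(eq_divn_dist d_gt0) : f (e w) %/ d = f (e w') %/ d by lia.
  by lia.
- by lia.
- by lia.
- have /(eq_divn_dist d_gt0) : (f (e w) - c) %/ d = (f (e w') - c) %/ d by lia.
  by lia.
Qed.

Lemma chromatic_number_near0 {G K : sgraph} {k d : nat} {f : G -> 'I_k}
    (e : K -> G) :
  kd_coloring d f -> {homo e : w w' / adj w w'} ->
  (forall w, ~~ (d <= f (e w) <= k - d)) -> chromatic_number K <= 2.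
Proof.
move=> fP eP near0; apply: (chromatic_number_le (fun w => f (e w) < d : nat)).
  by move=> w; case: (_ < d).
move=> w w' /eP /fP; have := near0 w; have := near0 w'.
have := ltn_ord (f (e w)); have := ltn_ord (f (e w')).
by case: (ltnP (f (e w)) d); case: (ltnP (f (e w')) d); lia.
Qed.

Lemma join_kd_colorable_ge {t : nat} {H : sgraph} {n : nat} {v : 'I_n -> H}
    {Hs : 'I_n -> sgraph} {k d : nat} :
  0 < t -> bijective v -> (forall i, chromatic_number (Hs i) = t) ->
  3 <= chromatic_number H -> 0 < d ->
  kd_colorable (join_graph v Hs) k d -> (t + 2) * d <= k.
Proof.
move=> t_gt0 [v' _ vK] Hs_t H_ge3 d_gt0 colG; rewrite leqNgt; apply/negP => k_lt.
pose x : join_graph v Hs := None.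
have [f fP fx0] := kd_coloring_rotate x colG.
pose inH (u : H) : join_graph v Hs := Some (inl u).
suff : chromatic_number H <= 2 by rewrite leqNgt H_ge3.
apply: (chromatic_number_near0 inH fP) => // u; apply/negP => u_far.
pose i := v' u.
pose inHs (w : Hs i) : join_graph v Hs :=
  Some (inr (Tagged (fun j => vertex (Hs j)) w)).
suff : chromatic_number (Hs i) <= t.-1 by rewrite Hs_t; lia.
apply: (chromatic_number_common_neighbors inHs d_gt0 _ fP fx0 u_far) => //.
- by have -> : t.-1 + 3 = t + 2 by lia.
- by move=> w w' ww'; rewrite /= eqxx tagged_asE.
- by move=> w; rewrite /= /i vK.
Qed.

Lemma kd_colorable_ex (G : sgraph) : exists2 k, 2 <= k & kd_colorable G k 1.
Proof.
pose r (y : G) : nat := enum_rank y.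
have r_lt y : r y < #|G|.+2 by apply/leqW/leqW/ltn_ord.
exists #|G|.+2 => //; exists (fun y => Ordinal (r_lt y)) => y z yz.
have : r y != r z.
  by apply: contraTneq yz => /val_inj/enum_rank_inj ->; rewrite adj_irrefl.
have := r_lt y; have := r_lt z; rewrite /=; move: #|G|.+2 (r y) (r z) => k a b.
by lia.
Qed.

(** A lower bound on the ratios transfers to the infimum only because some
    ratio exists, the infimum of the empty set being 0 by convention. *)
Lemma circular_chromatic_number_ge (R : realType) (G : sgraph) (m : nat) :
  (forall k d, 0 < d -> kd_colorable G k d -> m * d <= k) ->
  (m%:R <= circular_chromatic_number R G)%R.
Proof.
move=> ge_m; apply: lb_le_inf.
  have [k k_ge2 colG] := kd_colorable_ex G.
  by exists (k%:R / 1%:R)%R, k, 1; split.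
move=> _ [k [d [d_gt0 _ colG ->]]].
by rewrite Num.Theory.ler_pdivlMr ?Num.Theory.ltr0n // -GRing.natrM
  Num.Theory.ler_nat ge_m.
Qed.

Theorem theorem10 (R : realType) (t : nat) (H : sgraph) (n : nat)
    (v : 'I_n -> H) (Hs : 'I_n -> sgraph) :
  1 <= t ->
  bijective v ->
  (forall i : 'I_n, chromatic_number (Hs i) = t) ->
  3 <= chromatic_number H ->
  ((t + 2)%:R <= circular_chromatic_number R (join_graph v Hs))%R.
Proof.
move=> t_gt0 v_bij Hs_t H_ge3; apply: circular_chromatic_number_ge => k d.
exact: join_kd_colorable_ge.
Qed.
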